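(* For every integer $n \geq 4$, $$\mathrm{ex}_{\mathcal{P}}(n,C_{4}) \leq \frac{15}{7}(n-2).$$
   Context: Graphs are finite and simple. A graph is called $H$-free if it does not contain the graph $H$ as a subgraph (whether induced or not). $\mathrm{ex}_{\mathcal{P}}(n,H)$ denotes the maximum number of edges possible in a planar $H$-free graph on $n$ vertices. $C_{4}$ denotes the cycle of length $4$. *)

(* Defs.v *)
From mathcomp Require Import all_boot all_order all_algebra.
From mathcomp Require Import all_classical all_reals all_analysis.

Set Implicit Arguments.
Unset Strict Implicit.
Unset Printing Implicit Defensive.

Import Order.TTheory GRing.Theory Num.Theory.
Import numFieldNormedType.Exports.

Local Open Scope classical_set_scope.
Local Open Scope ring_scope.

Record sgraph (V : finType) := SGraph {
  adj :> rel V;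
  adj_sym : symmetric adj;
  adj_irr : irreflexive adj
}.

Definition edges (V : finType) (G : sgraph V) : {set {set V}} :=
  [set e : {set V} | [exists x, exists y, G x y && (e == [set x; y]%SET)]]%SET.

(* H is isomorphic to a subgraph of G, not necessarily induced. *)
Definition has_subgraph (W V : finType) (H : sgraph W) (G : sgraph V) : Prop :=
  exists f : W -> V, injective f /\ forall x y, H x y -> G (f x) (f y).

Definition free (W V : finType) (H : sgraph W) (G : sgraph V) : Prop :=
  ~ has_subgraph H G.

Definition cycle_rel (k : nat) : rel 'I_k := fun i j =>
  (i != j) && ((i.+1 %% k == j)%N || (j.+1 %% k == i)%N).

Lemma cycle_rel_sym k : symmetric (@cycle_rel k).
Proof. by move=> i j; rewrite /cycle_rel eq_sym orbC. Qed.

Lemma cycle_rel_irr k : irreflexive (@cycle_rel k).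
Proof. by move=> i; rewrite /cycle_rel eqxx. Qed.

(* The cycle of length k when k >= 3. *)
Definition cycle_graph (k : nat) : sgraph 'I_k :=
  SGraph (@cycle_rel_sym k) (@cycle_rel_irr k).

(* By compactness of [0, 1], such a g is a homeomorphism onto its image. *)
Definition simple_arc (R : realType) (g : R -> R * R) (p q : R * R) : Prop :=
  [/\ {within `[0, 1], continuous g},
      {in `[0, 1] &, injective g},
      g 0 = p & g 1 = q].

(* The vertices are drawn as distinct points and each edge as a simple arc
   joining its ends (parametrised in either direction), so that the interior of
   an edge contains no vertex and no point of any other edge. *)
Definition plane_drawing (R : realType) (V : finType) (G : sgraph V)
    (pos : V -> R * R) (arc : {set V} -> R -> R * R) : Prop :=
  [/\ injective pos,
      forall e, e \in edges G ->
        exists x y, e = [set x; y]%SET /\ simple_arc (arc e) (pos x) (pos y),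
      forall e (t : R) v, e \in edges G -> t \in `]0, 1[ -> arc e t <> pos v
    & forall e e' (t s : R), e \in edges G -> e' \in edges G -> e != e' ->
        t \in `]0, 1[ -> s \in `[0, 1] -> arc e t <> arc e' s].

Definition planar (R : realType) (V : finType) (G : sgraph V) : Prop :=
  exists (pos : V -> R * R) (arc : {set V} -> R -> R * R),
    plane_drawing G pos arc.

(* A graph on n vertices is taken, up to isomorphism, with vertex set 'I_n, and
   is determined by its edge set E. The maximum is 0 if no graph qualifies,
   which cannot happen when H has an edge, as the edgeless graph is planar. *)
Definition exP (R : realType) (n : nat) (W : finType) (H : sgraph W) : nat :=
  \max_(E : {set {set 'I_n}} |
      `[< exists G : sgraph 'I_n, [/\ edges G = E, planar R G & free H G] >])
    #|E|.

(* Main.v *)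
Require Import Defs.
From mathcomp Require Import all_boot all_order all_algebra.
From mathcomp Require Import all_classical all_reals all_analysis.
From mathcomp Require Import zify ring lra.

(** The count behind the bound is short. In a C4-free graph two triangles never
    share an edge, so at most e/3 faces are triangles, and all other faces have
    at least five edges; double counting gives 15 f <= 8 e, and Euler's formula
    f >= e - n + 2 turns this into 7 e <= 15 (n - 2).

    The difficulty is that planarity means a drawing with arbitrary continuous
    arcs, whose faces are not directly accessible. The proof uses no Jordan
    curve theorem. What the count needs is only an algebraic dual in the sense
    of Whitney and MacLane: two maps phi and psi sending every edge to the two
    faces beside it, such that the cycle space of G over the two-element field
    consists exactly of the chains alpha (phi e) + alpha (psi e), where alpha
    ranges over the labellings of the faces ([dual_ends]).

    A planar graph has such a dual because it is a minor of a square grid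
    ([coarse_drawing_minor], [planar_dual_ends]). By compactness there is a
    radius at which the squares around the vertices are disjoint and avoid the
    arcs not ending there, and, outside those squares, distinct arcs keep a
    positive distance. On a grid much finer than these distances, the grid
    points in the square of a vertex form a connected blob, and the grid points
    near an arc form a connected tube that links the blobs of its two ends;
    tubes of distinct edges meet only inside blobs. Splitting every tube between
    its ends gives disjoint connected branch sets, hence a minor
    ([minor_of_tubes]).

    In the grid every cycle bounds a set of cells, by counting crossings along
    a row ([grid_cycle_bounds]). For a minor G of the grid, the faces are the
    classes of cells that can reach each other without crossing an edge kept by
    G. A cycle of G lifts to the grid by adding paths inside the branch sets,
    its lift bounds a set of cells, and that set is a union of faces
    ([minor_dual_ends]).

    The dual so obtained may be disconnected, and then two faces may have the
    same boundary, which would spoil the count. Identifying two faces taken from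
    different components keeps it a dual, so it can be made connected
    ([connected_dual]). Euler's inequality is a rank computation ([euler_le]),
    and [edge_bound] does the count. *)

Set Implicit Arguments.
Unset Strict Implicit.
Unset Printing Implicit Defensive.

Import Order.TTheory GRing.Theory Num.Theory.
Import numFieldNormedType.Exports.

Local Open Scope ring_scope.

(** * Cycle space and algebraic duals *)

Section Chains.
Variables (V : finType) (G : sgraph V).

(** Chains take values in [bool], which is the two-element field: [+] is
    exclusive or. *)
Definition cycle_chain (z : {set V} -> bool) : Prop :=
  forall v, \sum_(e in edges G | v \in e) z e = 0.

(** MacLane's algebraic form of a dual graph: [phi e] and [psi e] are the faces
    on the two sides of [e], and the cuts of the dual are the cycles of [G]. *)
Definition dual_ends (C : finType) (phi psi : {set V} -> C) : Prop :=
  (forall alpha : C -> bool, cycle_chain (fun e => alpha (phi e) + alpha (psi e)))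
  /\ (forall z, cycle_chain z -> exists alpha : C -> bool,
       forall e, e \in edges G -> z e = alpha (phi e) + alpha (psi e)).

Definition ends_in (C : finType) (phi psi : {set V} -> C) (F : {set C}) :=
  forall e, e \in edges G -> phi e \in F /\ psi e \in F.

Lemma edgesP e :
  reflect (exists x y, [/\ G x y, x != y & e = [set x; y]%SET]) (e \in edges G).
Proof.
rewrite inE; apply: (iffP existsP) => [[x /existsP [y /andP [gxy /eqP ->]]]|].
  exists x, y; split=> //; apply: contraTneq gxy => ->; by rewrite adj_irr.
by case=> x [y [gxy _ ->]]; exists x; apply/existsP; exists y; rewrite gxy eqxx.
Qed.

Lemma addbool_nat (I : finType) (P Q : pred I) :
  (\sum_(i | P i) (Q i : bool) : bool) = odd #|[pred i | P i && Q i]|.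
Proof.
rewrite -sum1_card (big_morph odd oddD (erefl : odd 0 = false)).
rewrite [RHS]big_mkcondr /=.
by apply: eq_bigr => i _; case: (Q i).
Qed.

Lemma card_edge e : e \in edges G -> #|e| = 2%N.
Proof. by case/edgesP=> x [y [_ xy ->]]; rewrite cards2 xy. Qed.

(** Half of Euler's formula, e + 2 <= n + f. The incidence matrix [B] has rank at
    most n - 1, since every edge has two ends, so the cycle space has dimension
    at least e - n + 1. It lies in the row space of the dual incidence matrix
    [D], which has rank at most f - 1 for the same reason. *)
Lemma euler_le (C : finType) (phi psi : {set V} -> C) (F : {set C}) :
    dual_ends phi psi -> ends_in phi psi F ->
    (0 < #|V|)%N -> (0 < #|F|)%N ->
  (#|edges G| + 2 <= #|V| + #|F|)%N.
Proof.
move=> [_ span] inF V0 F0.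
pose E := edges G.
pose vx (j : 'I_#|V|) := enum_val j.
pose ed (i : 'I_#|E|) := enum_val i.
pose fc (k : 'I_#|F|) := enum_val k.
pose B : 'M[bool]_(#|_|, #|_|) := \matrix_(i, j) (vx j \in ed i).
pose D : 'M[bool]_(#|_|, #|_|) :=
  \matrix_(k, i) ((fc k == phi (ed i)) + (fc k == psi (ed i))).
have edE i : ed i \in edges G by exact: enum_valP.
have sumV (f : V -> bool) : \sum_v f v = \sum_j f (vx j).
  by rewrite (reindex vx) //; exact/onW_bij/enum_val_bij.
have sumE (P : pred _) (f : {set V} -> bool) :
    \sum_(e in edges G | P e) f e = \sum_i (P (ed i) * f (ed i)).
  rewrite -(@big_enum_val _ _ _ _ (mem E) (fun e => P e * f e)) /= big_mkcondr /=.
  by apply: eq_bigr => e _; case: (P e).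
have sumF (f : C -> bool) : \sum_(c in F) f c = \sum_k f (fc k).
  by rewrite -(@big_enum_val _ _ _ _ (mem F) f).
have rB : (\rank B + 1 <= #|V|)%N.
  have B1 : B *m (const_mx 1 : 'cV[bool]_#|V|) = 0.
    apply/matrixP=> i j; rewrite !mxE.
    under eq_bigr do rewrite !mxE mulr1.
    rewrite -(sumV (fun v => v \in ed i)) addbool_nat /=.
    rewrite (eq_card (B := mem (ed i))); last by move=> v; rewrite inE.
    by rewrite card_edge.
  have := mulmx0_rank_max B1; apply: leq_trans.
  rewrite leq_add2l lt0n mxrank_eq0; apply/negP=> /eqP/matrixP.
  have i0 : 'I_#|V| by exact: (Ordinal V0).
  by move=> /(_ i0 0); rewrite !mxE.
have rD : (\rank D + 1 <= #|F|)%N.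
  have D1 : (const_mx 1 : 'rV[bool]_#|F|) *m D = 0.
    apply/matrixP=> i j; rewrite !mxE.
    under eq_bigr do rewrite !mxE mul1r.
    rewrite big_split /= -(sumF (fun x => x == phi (ed j))) -(sumF (fun x => x == psi (ed j))).
    have one c : c \in F -> \sum_(x in F) (x == c : bool) = true.
      move=> cF; rewrite (bigD1 c) //= eqxx big1 ?addr0 // => x /andP [_ /negbTE->] //.
    by case: (inF _ (edE j)) => h1 h2; rewrite !one.
  have := mulmx0_rank_max D1; rewrite addnC; apply: leq_trans.
  rewrite leq_add2l lt0n mxrank_eq0; apply/negP=> /eqP/matrixP.
  by move=> /(_ 0 (Ordinal F0)); rewrite !mxE.
have sub : (kermx B <= D)%MS.
  apply/row_subP => r; set u := row r (kermx B).
  have uB : u *m B = 0 by apply/sub_kermxP; exact: row_sub.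
  pose z e := \sum_i (e == ed i) * u 0 i.
  have zE i : z (ed i) = u 0 i.
    rewrite /z (bigD1 i) //= eqxx mul1r big1 ?addr0 // => j ji.
    rewrite (_ : (ed i == ed j) = false) ?mul0r //.
    by apply/eqP=> /enum_val_inj ij; rewrite ij eqxx in ji.
  have zc : cycle_chain z.
    move=> v; rewrite sumE.
    transitivity ((u *m B) 0 (enum_rank v)); last by rewrite uB mxE.
    rewrite mxE; apply: eq_bigr => i _.
    by rewrite zE [B _ _]mxE /vx enum_rankK mulrC.
  have [alpha ha] := span _ zc.
  have -> : u = (\row_k alpha (fc k)) *m D.
    apply/rowP=> i; rewrite [RHS]mxE -zE ha //.
    under eq_bigr do rewrite !mxE mulrDr.
    rewrite big_split /=.
    have pick c : c \in F -> \sum_k alpha (fc k) * (fc k == c) = alpha c.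
      move=> cF; rewrite -(sumF (fun x => alpha x * (x == c))).
      rewrite (bigD1 c) //= eqxx mulr1 big1 ?addr0 // => x /andP [_ /negbTE->].
      by rewrite mulr0.
    by case: (inF _ (edE i)) => h1 h2; rewrite !pick.
  exact: submxMl.
have := mxrankS sub; rewrite mxrank_ker.
rewrite -/E in edE *.
move: rB rD; set rb := \rank B; set rd := \rank D; lia.
Qed.


(** The only union of components that meets [F] is all of [F]. *)
Definition dual_connected (C : finType) (phi psi : {set V} -> C) (F : {set C}) :=
  forall J : {set C}, (forall e, e \in edges G -> (phi e \in J) = (psi e \in J)) ->
    ~~ [disjoint J & F] -> F \subset J.

(** [J] is a union of components of the dual graph. The labelling [alpha] of a
    given cycle can be changed by a constant on [J] without changing the cycle;
    doing so makes [alpha j] and [alpha k] equal, and then [alpha] factors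
    through the identification of [j] with [k]. *)
Lemma merge_dual (C : finType) (phi psi : {set V} -> C) (J : {set C}) j k :
    dual_ends phi psi ->
    (forall e, e \in edges G -> (phi e \in J) = (psi e \in J)) ->
    j \in J -> k \notin J ->
  let m c := if c == j then k else c in
  dual_ends (m \o phi) (m \o psi).
Proof.
move=> [cyc span] Jc jJ kJ m; split=> [alpha|z /span [alpha ha]].
  exact: (cyc (alpha \o m)).
exists (fun c => alpha c + (alpha j + alpha k) * (c \in J)) => e eE.
rewrite ha // /m /=.
have mE c : alpha (if c == j then k else c) +
    (alpha j + alpha k) * ((if c == j then k else c) \in J)
    = alpha c + (alpha j + alpha k) * (c \in J).
  case: eqP => // ->; rewrite jJ (negbTE kJ).
  by case: (alpha j); case: (alpha k).
rewrite !mE (Jc e eE).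
by case: (alpha j); case: (alpha k); case: (psi e \in J);
  case: (alpha _); case: (alpha _).
Qed.

Lemma connected_dual (C : finType) (phi psi : {set V} -> C) (F : {set C}) :
    dual_ends phi psi -> ends_in phi psi F -> (0 < #|F|)%N ->
  exists phi' psi' : {set V} -> C, exists F' : {set C},
    [/\ dual_ends phi' psi', ends_in phi' psi' F', (0 < #|F'|)%N
      & dual_connected phi' psi' F'].
Proof.
have [n] := ubnP #|F|; elim: n => // n IH in phi psi F *.
rewrite ltnS => Fn dual inF F0.
have [con|] := pselect (dual_connected phi psi F); first by exists phi, psi, F.
move=> /existsNP [J] /not_implyP [Jc] /not_implyP [JF] /negP /subsetPn [k kF kJ].
have [j] := pred0Pn JF; rewrite /= => /andP [jJ jF].
have jk : k != j by apply: contraNneq kJ => ->.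
apply: (IH _ _ (F :\ j) _ (merge_dual dual Jc jJ kJ)).
- by move: Fn; rewrite (cardsD1 j F) jF.
- move=> e /inF [h1 h2]; rewrite /= !inE.
  have mF c : c \in F -> ((if c == j then k else c) != j) &&
      ((if c == j then k else c) \in F).
    by case: (eqVneq c j) => [_ _|-> ->] //; rewrite jk.
  by split; exact: mF.
- by apply/card_gt0P; exists k; rewrite !inE jk.
Qed.

(** * Short cycles in a graph without a four-cycle *)

Definition support (z : {set V} -> bool) : {set {set V}} :=
  [set e in edges G | z e]%SET.

Lemma in_support z e : (e \in support z) = (e \in edges G) && z e.
Proof. by rewrite inE. Qed.

Lemma even_degree z v : cycle_chain z ->
  ~~ odd #|[set e in support z | v \in e]%SET|.
Proof.
move/(_ v); rewrite addbool_nat => h.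
rewrite (eq_card (B := [pred i | (i \in edges G) && (v \in i) && z i])) ?h //.
by move=> e; rewrite !inE andbAC.
Qed.

(** Degrees in the support of a cycle are even, so one never gets stuck at a
    vertex; the small cases below all follow a cycle with this lemma. *)
Lemma next_edge z e v : cycle_chain z -> e \in support z -> v \in e ->
  exists2 e', e' \in support z & (v \in e') && (e' != e).
Proof.
move=> /(even_degree v) + eS ve; rewrite (cardsD1 e) inE eS ve /= => /negPn.
move=> /odd_gt0 /card_gt0P [e'].
by rewrite !inE => /and3P [ne eS' ve']; exists e'; rewrite ?inE ?eS' ?ve'.
Qed.

Lemma other_end e v : e \in edges G -> v \in e ->
  exists w, [/\ e = [set v; w]%SET, w != v & G v w].
Proof.
case/edgesP=> x [y [gxy xy ->]]; rewrite !inE => /orP [] /eqP->.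
  by exists y; rewrite eq_sym.
by exists x; rewrite finset.setUC adj_sym.
Qed.

Lemma edge_eq e f x y : e \in edges G -> f \in edges G -> x != y ->
  x \in e -> y \in e -> x \in f -> y \in f -> e = f.
Proof.
move=> eE fE xy xe ye xf yf.
suff h g : g \in edges G -> x \in g -> y \in g -> g = [set x; y]%SET.
  by rewrite (h e) // (h f).
move=> gE xg yg; apply/esym/eqP.
by rewrite eqEcard card_edge // cards2 xy andbT finset.subUset !finset.sub1set xg.
Qed.

Lemma supportW z e : e \in support z -> e \in edges G.
Proof. by rewrite inE => /andP []. Qed.

Lemma support_card_neq1 z : cycle_chain z -> #|support z| != 1%N.
Proof.
move=> zc; apply/negP=> /cards1P [e se].
have eS : e \in support z by rewrite se inE.
have [x [y [_ _ ee]]] := edgesP _ (supportW eS).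
have xe : x \in e by rewrite ee !inE eqxx.
by have [f] := next_edge zc eS xe; rewrite se inE => /eqP->; rewrite eqxx andbF.
Qed.

Lemma support_card_neq2 z : cycle_chain z -> #|support z| != 2%N.
Proof.
move=> zc; apply/negP=> /cards2P [e [f [ef se]]].
have eS : e \in support z by rewrite se !inE eqxx.
have fS : f \in support z by rewrite se !inE eqxx orbT.
have [x [y [_ xy ee]]] := edgesP _ (supportW eS).
have sub v : v \in e -> v \in f.
  move=> ve; have [g] := next_edge zc eS ve; rewrite se !inE.
  by case/orP=> /eqP->; rewrite ?eqxx ?andbF // => /andP [].
case/eqP: ef; apply: (@edge_eq _ _ x y) => //; rewrite ?(supportW eS) ?(supportW fS) //.
- by rewrite ee !inE eqxx.
- by rewrite ee !inE eqxx orbT.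
- by apply: sub; rewrite ee !inE eqxx.
- by apply: sub; rewrite ee !inE eqxx orbT.
Qed.

Lemma square_subgraph x y w u : uniq [:: x; y; w; u] ->
  G x y -> G y w -> G w u -> G u x -> has_subgraph (cycle_graph 4) G.
Proof.
move=> un gxy gyw gwu gux; exists (tnth [tuple x; y; w; u]); split.
  by apply/tuple_uniqP.
have sym := adj_sym G.
case=> [[|[|[|[|//]]]] i] [[|[|[|[|//]]]] j]; rewrite /= /cycle_rel //= !(tnth_nth x) /=;
  by rewrite // sym.
Qed.

(** Walking along the four edges either closes a square, or closes a triangle and
    leaves a single edge, both ends of which would have to lie on the triangle. *)
Lemma support_card_neq4 z : Defs.free (cycle_graph 4) G -> cycle_chain z ->
  #|support z| != 4%N.
Proof.
move=> fr zc; apply/negP=> /eqP S4; apply: fr.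
have [e1 e1S] : exists e, e \in support z by apply/card_gt0P; rewrite S4.
have [x [y [gxy xy E1]]] := edgesP _ (supportW e1S).
have nxt e v := @next_edge z e v zc.
have ye1 : y \in e1 by rewrite E1 !inE eqxx orbT.
have [e2 e2S /andP [ye2 e21]] := nxt _ _ e1S ye1.
have [w [E2 wy gyw]] := other_end (supportW e2S) ye2.
have xw : x != w.
  by apply: contraNneq e21 => xw; rewrite E2 E1 -xw finset.setUC.
have we2 : w \in e2 by rewrite E2 !inE eqxx orbT.
have [e3 e3S /andP [we3 e32]] := nxt _ _ e2S we2.
have [u [E3 uw gwu]] := other_end (supportW e3S) we3.
have uy : u != y.
  by apply: contraNneq e32 => uy; rewrite E3 E2 uy finset.setUC.
have e31 : e3 != e1.
  apply/negP=> /eqP h; move: we3; rewrite h E1 !inE => /orP [] /eqP wE.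
    by rewrite wE eqxx in xw.
  by rewrite wE eqxx in wy.
have inS s : uniq s -> size s = 4%N -> {subset s <= support z} -> support z =i s.
  move=> us s4 sub f; apply/esym.
  have: #|s| = #|support z| by rewrite S4 -s4; apply/card_uniqP.
  by move/subset_cardP => h; apply: h; apply/fintype.subsetP.
have un f : f != e1 -> f != e2 -> f != e3 -> uniq [:: f; e1; e2; e3].
  move=> f1 f2 f3; rewrite /= !inE !negb_or f1 f2 f3 /=.
  by rewrite eq_sym e21 eq_sym e31 eq_sym e32.
have sub f : f \in support z -> {subset [:: f; e1; e2; e3] <= support z}.
  by move=> fS g; rewrite !in_cons in_nil orbF => /or4P [] /eqP->.
have [ux|ux] := eqVneq u x.
  (* The triangle case: both ends of the fourth edge lie on the triangle. *)
  have [e4 e4S] : exists2 f, f \in support z & f \notin [:: e1; e2; e3].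
    apply/subsetPn/negP=> /subset_leq_card; rewrite S4.
    by move/leq_trans/(_ (card_size _)).
  rewrite !inE !negb_or => /and3P [e41 e42 e43].
  have SE := inS _ (un _ e41 e42 e43) erefl (sub _ e4S).
  have tri v : v \in e4 -> v \in [:: x; y; w].
    move=> ve4; have [f fS /andP [vf fe4]] := nxt _ _ e4S ve4.
    move: fS; rewrite SE !inE (negbTE fe4) /=.
    by case/or3P=> /eqP fE; move: vf; rewrite fE ?E1 ?E2 ?E3 ?ux !inE => /orP [] ->;
      rewrite ?orbT.
  have [p [q [_ pq E4]]] := edgesP _ (supportW e4S).
  have pe4 : p \in e4 by rewrite E4 !inE eqxx.
  have qe4 : q \in e4 by rewrite E4 !inE eqxx orbT.
  have no f : f \in [:: e1; e2; e3] -> p \in f -> q \in f -> False.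
    move=> fin pf qf; suff ff : f = e4.
      by move: fin; rewrite ff !inE (negbTE e41) (negbTE e42) (negbTE e43).
    apply: (@edge_eq _ _ p q) => //; last exact: supportW e4S.
    move: fin; rewrite !in_cons in_nil orbF.
    by case/or3P=> /eqP->; apply: (@supportW z).
  exfalso; move: (tri _ pe4) (tri _ qe4); rewrite !inE.
  case/or3P=> /eqP pE /or3P [] /eqP qE; subst p q; rewrite ?eqxx // in pq;
    first [ by apply: (no e1); rewrite ?inE ?eqxx ?orbT // E1 !inE eqxx ?orbT
          | by apply: (no e2); rewrite ?inE ?eqxx ?orbT // E2 !inE eqxx ?orbT
          | by apply: (no e3); rewrite ?inE ?eqxx ?orbT // E3 ux !inE eqxx ?orbT ].
have ue3 : u \in e3 by rewrite E3 !inE eqxx orbT.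
have [e4 e4S /andP [ue4 e43]] := nxt _ _ e3S ue3.
have e41 : e4 != e1.
  by apply: contraTneq ue4 => ->; rewrite E1 !inE negb_or ux.
have e42 : e4 != e2.
  by apply: contraTneq ue4 => ->; rewrite E2 !inE negb_or uw uy.
have SE := inS _ (un _ e41 e42 e43) erefl (sub _ e4S).
have xe1 : x \in e1 by rewrite E1 !inE eqxx.
have [f fS /andP [xf fe1]] := nxt _ _ e1S xe1.
have xe4 : x \in e4.
  move: fS; rewrite SE !inE (negbTE fe1) /=.
  case/or3P=> /eqP fE; move: xf; rewrite fE // ?E2 ?E3 !inE ?(negbTE xy) ?(negbTE xw) //=.
  by rewrite eq_sym (negbTE ux).
have [v [E4 vu guv]] := other_end (supportW e4S) ue4.
have xv : x = v.
  by move: xe4; rewrite E4 !inE eq_sym (negbTE ux) => /eqP.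
apply: (@square_subgraph x y w u) => //; last by rewrite xv.
rewrite /= !inE !negb_or xy xw eq_sym ux eq_sym wy.
by rewrite eq_sym uy eq_sym uw.
Qed.

Lemma cycle_chainD z1 z2 : cycle_chain z1 -> cycle_chain z2 ->
  cycle_chain (fun e => z1 e + z2 e).
Proof. by move=> h1 h2 v; rewrite big_split /= h1 h2. Qed.

(** Distinct triangles sharing an edge would sum to a cycle with four or two
    edges. *)
Lemma triangles_disjoint z1 z2 e : Defs.free (cycle_graph 4) G ->
  cycle_chain z1 -> cycle_chain z2 -> #|support z1| = 3%N -> #|support z2| = 3%N ->
  e \in support z1 -> e \in support z2 -> support z1 = support z2.
Proof.
move=> fr c1 c2 s1 s2 e1 e2.
have c := cycle_chainD c1 c2.
set z := (fun _ => _) in c.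
have sz : support z = ((support z1 :\: support z2) :|: (support z2 :\: support z1))%SET.
  apply/setP=> f; rewrite !(finset.in_setU, finset.in_setD, in_support) /z.
  by case: (f \in edges G); case: (z1 f); case: (z2 f).
have dis : ((support z1 :\: support z2) :&: (support z2 :\: support z1))%SET = finset.set0.
  apply/setP=> f; rewrite finset.in_setI !finset.in_setD !in_support finset.in_set0.
  by case: (f \in edges G); case: (z1 f); case: (z2 f).
have csz : #|support z| = (#|support z1 :\: support z2| + #|support z2 :\: support z1|)%N.
  by rewrite sz cardsU dis cards0 subn0.
have i0 : (0 < #|support z1 :&: support z2|)%N.
  by apply/card_gt0P; exists e; apply/setIP.
have := cardsID (support z2) (support z1); have := cardsID (support z1) (support z2).
rewrite finset.setIC s1 s2 => h2 h1.
have := support_card_neq4 fr c; have := support_card_neq2 c => /eqP n2 /eqP n4.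
have h0 : #|support z1 :&: support z2| = 3%N by lia.
have full (A : {set {set V}}) : #|A| = 3%N -> support z1 :&: support z2 \subset A ->
    (support z1 :&: support z2)%SET = A.
  by move=> A3 sub; apply/eqP; rewrite eqEcard sub h0 A3.
by rewrite -[LHS](full _ s1) ?finset.subsetIl // (full _ s2) ?finset.subsetIr.
Qed.

(** * The count *)

(** With at most two faces, Euler's inequality gives e <= n, which suffices for
    n >= 4. Otherwise the boundaries of the faces are nonempty and pairwise
    distinct: a face with empty boundary, or two faces with the same boundary,
    would form a union of components of the dual. *)
Lemma edge_bound (C : finType) (phi psi : {set V} -> C) :
    Defs.free (cycle_graph 4) G -> dual_ends phi psi -> (4 <= #|V|)%N ->
    (0 < #|C|)%N ->
  (7 * #|edges G| <= 15 * (#|V| - 2))%N.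
Proof.
move=> fr dual0 V4 C0.
have [||{C0 dual0} {}phi [{}psi [F [dual inF F0 con]]]] :=
  connected_dual (F := [set: C]%SET) dual0.
- by move=> e _; rewrite !inE.
- by rewrite cardsT.
have V0 : (0 < #|V|)%N by lia.
have euler := euler_le dual inF V0 F0.
have [F3|F3] := ltnP #|F| 3; first lia.
(* [S c] is the boundary of the face [c], and [T] below collects the triangular
   faces. *)
pose M c e := (c == phi e : bool) + (c == psi e : bool).
pose S c := support (M c).
have Mc c : cycle_chain (M c).
  have h := dual.1 (fun x => c == x).
  exact: h.
have S0 c : c \in F -> S c != finset.set0.
  move=> cF; apply/eqP=> S0.
  have : F \subset [set c]%SET.
    apply: con => [e eE|].
      have : e \notin S c by rewrite S0 inE.
      by rewrite !in_support eE /M /= !inE (eq_sym c) (eq_sym c);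
        case: (phi e == c); case: (psi e == c).
    by apply/pred0Pn; exists c; rewrite /= !inE eqxx.
  by move/subset_leq_card; rewrite cards1; lia.
have Sinj c d : c \in F -> d \in F -> S c = S d -> c = d.
  move=> cF dF Scd; apply/eqP/negPn/negP=> cd.
  have : F \subset [set c; d]%SET.
    apply: con => [e eE|]; last by apply/pred0Pn; exists c; rewrite /= !inE eqxx.
    have : (e \in S c) = (e \in S d) by rewrite Scd.
    rewrite !in_support eE /M /= !inE (eq_sym c) (eq_sym c) (eq_sym d) (eq_sym d).
    have ex x : (x == c) && (x == d) = false.
      by apply/negP=> /andP [/eqP-> h]; rewrite h in cd.
    move: (ex (phi e)) (ex (psi e)).
    by case: (phi e == c); case: (psi e == c); case: (phi e == d); case: (psi e == d).
  by move/subset_leq_card; rewrite cards2 cd; lia.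
pose T := [set c in F | #|S c| == 3%N]%SET.
have Sge c : c \in F -> (5 <= #|S c| + 2 * (c \in T))%N.
  move=> cF; rewrite inE cF /=.
  have := S0 c cF; rewrite -card_gt0.
  have := support_card_neq1 (Mc c); have := support_card_neq2 (Mc c).
  have := support_card_neq4 fr (Mc c); rewrite -/(S c).
  by move=> n4 n2 n1 n0; case: eqP => [->|n3]; [done|];
    move: n0 n1 n2 n4 n3; case: #|_| => [|[|[|[|[|]]]]].
have Ssum c : #|S c| = (\sum_(e in edges G) M c e)%N.
  rewrite -sum1dep_card big_mkcondr /=.
  by apply: eq_bigr => e _; case: (M c e).
have sumS : (\sum_(c in F) #|S c| <= 2 * #|edges G|)%N.
  under eq_bigr do rewrite Ssum.
  rewrite exchange_big /= mulnC -sum_nat_const; apply: leq_sum => e eE.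
  have le c : (M c e <= (c == phi e) + (c == psi e))%N.
    by rewrite /M; case: (c == _); case: (c == _).
  apply: (leq_trans (leq_sum _ (fun c _ => le c))); rewrite big_split /=.
  have one d : (\sum_(c in F) (c == d) <= 1)%N.
    have [dF|dF] := boolP (d \in F).
      rewrite (bigD1 d) //= eqxx big1 // => c /andP [_ /negbTE->] //.
    rewrite big1 // => c cF; case: eqP => // cd; by rewrite -cd cF in dF.
  exact: (leq_add (one _) (one _)).
(* Every edge is on at most one triangle. *)
have sumT : (3 * #|T| <= #|edges G|)%N.
  have -> : (3 * #|T| = \sum_(c in T) #|S c|)%N.
    rewrite mulnC -sum_nat_const; apply: eq_bigr => c.
    by rewrite inE => /andP [_ /eqP].
  under eq_bigr do rewrite Ssum.
  rewrite exchange_big /= -sum1_card; apply: leq_sum => e eE.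
  have [/existsP [c /andP [cT ce]]|/existsPn no] := boolP [exists c, (c \in T) && M c e].
    rewrite (bigD1 c) //= ce big1 // => d /andP [dT dc].
    case de: (M d e) => //; case/eqP: dc.
    move: cT dT; rewrite !inE => /andP [cF /eqP c3] /andP [dF /eqP d3].
    apply: Sinj => //; apply: (triangles_disjoint (e := e) fr) => //; rewrite inE eE //.
  by rewrite big1 // => c cT; have := no c; rewrite cT /=; case: (M c e).
have : (\sum_(c in F) 5 <= \sum_(c in F) (#|S c| + 2 * (c \in T)))%N.
  exact: leq_sum.
rewrite sum_nat_const big_split /= -big_distrr /=.
have -> : (\sum_(c in F) (c \in T) = #|T|)%N.
  rewrite -sum1_card [RHS](eq_bigl (fun c => (c \in F) && (c \in T))).
    by rewrite big_mkcondr /=; apply: eq_bigr => c _; case: (c \in T).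
  by move=> c; rewrite !inE; case: (c \in F).
move: euler sumS sumT V4.
move: (\sum_(c in F) _)%N #|T| #|F| #|V| #|edges G| => s t f n m.
clear; lia.
Qed.

End Chains.

(** * Algebraic duals of minors of a plane complex *)

Section Complex.
Variables (V : finType) (G : sgraph V) (T D C : finType).
Variables (src tgt : D -> T) (lft rgt : D -> C).

(** The boundary modulo two. [T], [D] and [C] are the vertices, edges and cells of
    a complex; the edge [d] goes from [src d] to [tgt d] and has the cells [lft d]
    and [rgt d] beside it. *)
Definition bd (z : D -> bool) (a : T) : bool :=
  \sum_d z d * ((a == src d : bool) + (a == tgt d : bool)).

Definition joined : rel T := fun a b =>
  [exists d, ((src d == a) && (tgt d == b)) || ((src d == b) && (tgt d == a))].

Variables (lab : T -> option V) (hat : {set V} -> D) (inner : pred D).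

Definition blob_rel : rel T := fun a b => (lab a == lab b) && joined a b.

(** The points labelled [Some v] form the branch set of [v], and [hat e] is an
    edge of the complex joining the branch sets of the two ends of [e]. Labels
    make branch sets disjoint by construction. *)
Definition is_minor : Prop :=
  (forall e, e \in edges G -> exists x y, [/\ e = [set x; y]%SET, x != y,
      lab (src (hat e)) = Some x & lab (tgt (hat e)) = Some y])
  /\ (forall v a b, lab a = Some v -> lab b = Some v -> connect blob_rel a b).

Hypothesis minorG : is_minor.
Hypothesis boundary_boundary : forall (c : C -> bool) a,
  bd (fun d => c (lft d) + c (rgt d)) a = 0.
(** [inner] selects a region where the complex is planar, so that the complex may
    be wrapped around elsewhere. *)
Hypothesis inner_lab : forall d, lab (src d) || lab (tgt d) -> inner d.
Hypothesis cycle_bounds : forall z : D -> bool,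
  (forall d, z d -> lab (src d) && lab (tgt d)) -> (forall a, bd z a = 0) ->
  exists c : C -> bool, forall d, inner d -> z d = c (lft d) + c (rgt d).

Lemma bd_sum (I : finType) (P : pred I) (z : I -> D -> bool) a :
  bd (fun d => \sum_(i | P i) z i d) a = \sum_(i | P i) bd (z i) a.
Proof.
by rewrite /bd exchange_big; apply: eq_bigr => d _; rewrite mulr_suml.
Qed.

Lemma bdD z1 z2 a : bd (fun d => z1 d + z2 d) a = bd z1 a + bd z2 a.
Proof. by rewrite /bd -big_split; apply: eq_bigr => d _; rewrite mulrDl. Qed.

Lemma bd_scale b z a : bd (fun d => b * z d) a = b * bd z a.
Proof. by rewrite /bd mulr_sumr; apply: eq_bigr => d _; rewrite mulrA. Qed.

Lemma bd_edge d0 a : bd (fun d => d == d0) a = (a == src d0 : bool) + (a == tgt d0 : bool).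
Proof.
by rewrite /bd (bigD1 d0) //= eqxx mul1r big1 ?addr0 // => d /negbTE->; rewrite mul0r.
Qed.

(** A path inside a branch set, read as a chain. *)
Lemma path_chain v a b : lab a = Some v -> connect blob_rel a b ->
  exists p : D -> bool,
    (forall d, p d -> lab (src d) = Some v /\ lab (tgt d) = Some v) /\
    forall x, bd p x = (x == a : bool) + (x == b : bool).
Proof.
move=> + /connectP [s]; elim: s a => [|c s IH] a /= av.
  move=> _ ->; exists (fun _ => false); split=> // x.
  by rewrite /bd big1 => [|d _]; [case: (x == a)|rewrite mul0r].
move=> /andP [/andP [/eqP labE /existsP [d ends]] ps] bE.
have cv : lab c = Some v by rewrite -labE.
have [p [pv pbd]] := IH c cv ps bE.
exists (fun d' => (d' == d : bool) + p d'); split.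
  move=> d'; case: eqP => [-> _|_ /pv //].
  by case/orP: ends => /andP [/eqP-> /eqP->].
move=> x; rewrite bdD pbd bd_edge.
by case/orP: ends => /andP [/eqP-> /eqP->];
  case: (x == a); case: (x == c); case: (x == b).
Qed.

(** A base point of each branch set; it is [None] for an empty one. *)
Definition root_of v : option T := [pick a | lab a == Some v].

Lemma root_of_lab v x : root_of v = Some x -> lab x = Some v.
Proof. by rewrite /root_of; case: pickP => // y /eqP yv [<-]. Qed.

Lemma root_chains : exists p : T -> D -> bool, forall a v, lab a = Some v ->
    (forall d, p a d -> lab (src d) = Some v /\ lab (tgt d) = Some v) /\
    forall x, bd (p a) x = (x == a : bool) + (Some x == root_of v : bool).
Proof.
suff /boolp.choice [p hp] : forall a, exists p : D -> bool, forall v, lab a = Some v ->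
    (forall d, p d -> lab (src d) = Some v /\ lab (tgt d) = Some v) /\
    forall x, bd p x = (x == a : bool) + (Some x == root_of v : bool).
  by exists p.
move=> a.
case av: (lab a) => [v|]; last by exists (fun _ => false).
have [r rE] : exists r, root_of v = Some r.
  by rewrite /root_of; case: pickP => [r _|/(_ a)]; [exists r|rewrite av eqxx].
have [p [ps pb]] := path_chain av (minorG.2 _ _ _ av (root_of_lab rE)).
exists p => w [<-]; split=> // x; rewrite pb rE.
by congr (_ + _); apply/eqP/eqP => [->|[]].
Qed.

Lemma hat_inj : {in edges G &, injective hat}.
Proof.
move=> e f /(minorG.1 _) [x [y [-> _ sx ty]]] /(minorG.1 _) [x' [y' [-> _ sx' ty']]] h.
by move: sx ty; rewrite h sx' ty' => -[->] [->].
Qed.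

(** The edges of the complex that survive in the minor before contraction. Cells
    separated by any other inner edge belong to the same face. *)
Definition kept (d : D) : bool :=
  (lab (src d) && (lab (src d) == lab (tgt d))) || [exists e in edges G, d == hat e].

Definition cell_rel : rel C := fun c c' => [exists d, [&& inner d, ~~ kept d &
  ((lft d == c) && (rgt d == c')) || ((lft d == c') && (rgt d == c))]].

Lemma cell_rel_sym : connect_sym cell_rel.
Proof.
apply: sym_connect_sym => c c'; rewrite /cell_rel.
by apply: eq_existsb => d; rewrite orbC.
Qed.

Definition face (c : C) := fingraph.root cell_rel c.

Lemma cell_const (c : C -> bool) :
  (forall d, inner d -> ~~ kept d -> c (lft d) = c (rgt d)) ->
  forall x, c (face x) = c x.
Proof.
move=> h x; rewrite /face; have /connectP [s ps ->] := connect_root cell_rel x.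
elim: s x ps => //= y s IH x /andP [/existsP [d /and3P [di dk de]] ps].
rewrite (IH _ ps); have := h d di dk.
by case/orP: de => /andP [/eqP-> /eqP->].
Qed.

(** Summing the boundary of [z] over the branch set of [v], edges inside the
    branch set cancel and only the edges [hat e] with [v] in [e] remain. *)
Lemma cut_vertex_sum v (z : D -> bool) :
  (forall a, bd z a = 0) -> (forall d, inner d -> ~~ kept d -> z d = 0) ->
  \sum_(e in edges G | v \in e) z (hat e) = 0.
Proof.
move=> zc zk.
pose cut d := (lab (src d) == Some v : bool) + (lab (tgt d) == Some v : bool).
have : \sum_(a | lab a == Some v) bd z a = 0 by rewrite big1.
rewrite /bd exchange_big /=.
have -> : \sum_d \sum_(a | lab a == Some v) z d * ((a == src d : bool) + (a == tgt d : bool))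
    = \sum_d z d * cut d.
  apply: eq_bigr => d _; rewrite -mulr_sumr big_split /=; congr (_ * (_ + _)).
    rewrite big_mkcond (bigD1 (src d)) //= eqxx big1 ?addr0 => [|a /negbTE->]; by case: ifP.
  rewrite big_mkcond (bigD1 (tgt d)) //= eqxx big1 ?addr0 => [|a /negbTE->]; by case: ifP.
move=> h0; apply: etrans h0.
transitivity (\sum_(e in [set e in edges G | v \in e]%SET) z (hat e)).
  by apply: eq_bigl => e; rewrite finset.in_set.
rewrite -(big_imset z (h := hat) (A := [set e in edges G | v \in e]%SET)) /=; last first.
  by move=> e f /finset.setIdP [eE _] /finset.setIdP [fE _]; exact: hat_inj.
rewrite [RHS](bigID (fun d => d \in [set hat e | e in [set e in edges G | v \in e]]%SET)) /=.
rewrite [X in _ = _ + X]big1 ?addr0.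
  apply: eq_bigr => d /imsetP [e /finset.setIdP [eE ve] ->].
  have [x [y [ee xy sx ty]]] := minorG.1 e eE.
  rewrite /cut sx ty; move: ve; rewrite ee !inE.
  case/orP=> /eqP vE; rewrite -vE !(inj_eq Some_inj) eqxx in xy *.
    by rewrite eq_sym (negbTE xy) mulr1.
  by rewrite (negbTE xy) mulr1.
move=> d dn; have [|_] := boolP (cut d); last by rewrite mulr0.
rewrite mulr1 => cd; have di : inner d.
  by apply: inner_lab; move: cd; rewrite /cut; do 2 case: eqP => [->|_]; rewrite ?orbT.
rewrite zk //; apply/negP=> /orP [/andP [_ /eqP h]|].
  by move: cd; rewrite /cut h; case: (_ == _).
case/existsP=> e /andP [eE /eqP dE].
move/imsetP: dn; apply; exists e => //; apply/finset.setIdP; split=> //.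
have [x [y [ee xy sx ty]]] := minorG.1 e eE.
by move: cd; rewrite /cut dE sx ty ee !(inj_eq Some_inj) !inE !(eq_sym v);
  case: (x == v); case: (y == v).
Qed.

(** Inside a branch set, join the ends of the edges [hat e] to the base point; the
    contributions at the base point cancel because degrees of [z] are even. *)
Lemma lift_cycle z : cycle_chain G z -> exists zt : D -> bool,
  [/\ forall d, zt d -> kept d, forall a, bd zt a = 0
    & forall e, e \in edges G -> zt (hat e) = z e].
Proof.
move=> zc; have [p hp] := root_chains.
have hpk d e : e \in edges G -> p (src (hat e)) d || p (tgt (hat e)) d ->
    lab (src d) && (lab (src d) == lab (tgt d)).
  move=> eE; have [x [y [_ _ sx ty]]] := minorG.1 e eE.
  by case/orP=> [/(hp _ _ sx).1|/(hp _ _ ty).1] [-> ->]; rewrite eqxx.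
exists (fun d => \sum_(e in edges G)
   z e * ((d == hat e : bool) + (p (src (hat e)) d + p (tgt (hat e)) d))); split.
- move=> d; apply: contraTT => nk; rewrite big1 // => e eE.
  have := hpk d e eE; have : d != hat e.
    by apply: contraNneq nk => ->; apply/orP; right; apply/existsP; exists e; rewrite eE eqxx.
  move: nk; rewrite /kept negb_or => /andP [/negbTE-> _] /negbTE-> /contraFF /(_ erefl).
  by move=> /norP [/negbTE-> /negbTE->]; rewrite !addr0 mulr0.
- move=> a; rewrite bd_sum.
  case av: (lab a) => [v|]; last first.
    apply: big1 => e eE; have [x [y [_ _ sx ty]]] := minorG.1 e eE.
    rewrite bd_scale !bdD bd_edge (hp _ _ sx).2 (hp _ _ ty).2.
    have nr w : (Some a == root_of w) = false.
      by apply/eqP=> /esym /root_of_lab; rewrite av.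
    by rewrite !nr; case: (a == src _); case: (a == tgt _); rewrite mulr0.
  transitivity (\sum_(e in edges G) (Some a == root_of v : bool) * (if v \in e then z e else 0)).
    apply: eq_bigr => e eE; have [x [y [ee xy sx ty]]] := minorG.1 e eE.
    rewrite bd_scale !bdD bd_edge (hp _ _ sx).2 (hp _ _ ty).2.
    have nr w : v != w -> (Some a == root_of w) = false.
      by move=> wv; apply/eqP=> /esym /root_of_lab; rewrite av => -[vw]; rewrite vw eqxx in wv.
    rewrite (_ : (v \in e) = (v == x) || (v == y)); last by rewrite ee !inE.
    move: xy; have [<-|vx] := eqVneq v x; have [<-|vy] := eqVneq v y; rewrite ?eqxx // => _.
    + rewrite (nr y vy) /=.
      by case: (z e); case: (a == src _); case: (a == tgt _); case: (_ == root_of v).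
    + rewrite (nr x vx) /=.
      by case: (z e); case: (a == src _); case: (a == tgt _); case: (_ == root_of v).
    + rewrite (nr x vx) (nr y vy) /=.
      by case: (z e); case: (a == src _); case: (a == tgt _); case: (_ == root_of v).
  by rewrite -mulr_sumr -big_mkcondr zc mulr0.
- move=> e eE.
  have pF f : f \in edges G -> (p (src (hat f)) (hat e) = false) * (p (tgt (hat f)) (hat e) = false).
    move=> fE; have [x [y [_ xy sx ty]]] := minorG.1 e eE.
    have := contraNN (hpk (hat e) f fE); rewrite sx ty (inj_eq Some_inj) (negbTE xy) /=.
    by move=> /(_ isT); rewrite negb_or => /andP [/negbTE-> /negbTE->].
  rewrite (bigD1 e) //= eqxx !pF // big1 => [|f /andP [fE fe]].
    by rewrite !addr0 mulr1.
  rewrite !pF //; have -> : (hat e == hat f) = false.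
    by apply/eqP=> /(hat_inj eE fE) ef; rewrite ef eqxx in fe.
  by rewrite !addr0 mulr0.
Qed.

(** A labelling of faces is a set of cells whose coboundary lives on kept edges,
    so it contracts to a cycle of [G]. Conversely the lift of a cycle bounds a set
    of cells, which cannot change across an edge that is not kept. *)
Lemma minor_dual_ends :
  dual_ends G (fun e => face (lft (hat e))) (fun e => face (rgt (hat e))).
Proof.
have fc d : inner d -> ~~ kept d -> face (lft d) = face (rgt d).
  move=> di dk; apply/(fingraph.rootP cell_rel_sym).
  by apply: connect1; apply/existsP; exists d; rewrite di dk !eqxx.
have inner_hat e : e \in edges G -> inner (hat e).
  by move=> eE; apply: inner_lab; have [x [y [_ _ -> _]]] := minorG.1 e eE.
split=> [alpha v|z zc].
  apply: (@cut_vertex_sum v (fun d => alpha (face (lft d)) + alpha (face (rgt d)))).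
    by move=> a; apply: (boundary_boundary (alpha \o face)).
  by move=> d di dk; rewrite fc //; case: (alpha _).
have [zt [zk zb ze]] := lift_cycle zc.
have [|c hc] := cycle_bounds _ zb.
  move=> d /zk /orP [/andP [s /eqP <-]|/existsP [e /andP [eE /eqP ->]]].
    by rewrite s.
  by have [x [y [_ _ -> ->]]] := minorG.1 e eE.
exists c => e eE; rewrite !cell_const.
- by rewrite -ze // hc ?inner_hat.
- move=> d di dk; have := hc d di; have : zt d = false by apply: contraNF dk => /zk.
  by move=> ->; case: (c _); case: (c _).
- move=> d di dk; have := hc d di; have : zt d = false by apply: contraNF dk => /zk.
  by move=> ->; case: (c _); case: (c _).
Qed.

End Complex.

(** * The square grid *)

Section Grid.
Variable N : nat.

Definition gpoint := ('I_N * 'I_N)%type.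
(** The edge [(a, false)] leaves [a] in the first coordinate and [(a, true)] in
    the second. Coordinates are cyclic, so that the boundary of a chain is given
    by the same formula at all points; only points off the border get labels.
    The cell [a] has [a] as the corner with smallest coordinates. *)
Definition gedge := (gpoint * bool)%type.

Definition gsrc (d : gedge) : gpoint := d.1.
Definition gtgt (d : gedge) : gpoint :=
  if d.2 then (d.1.1, ordS d.1.2) else (ordS d.1.1, d.1.2).
Definition grgt (d : gedge) : gpoint := d.1.
Definition glft (d : gedge) : gpoint :=
  if d.2 then (ord_pred d.1.1, d.1.2) else (d.1.1, ord_pred d.1.2).

Lemma sum_pick (I : finType) (f : I -> bool) (Q : pred I) b :
  (forall x, Q x = (x == b)) -> \sum_x f x * (Q x : bool) = f b.
Proof.
move=> Qb; rewrite (bigD1 b) //= Qb eqxx mulr1 big1 ?addr0 // => x /negbTE xb.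
by rewrite Qb xb mulr0.
Qed.

Lemma grid_bd (z : gedge -> bool) (a : gpoint) :
  bd gsrc gtgt z a = z (a, true) + z ((a.1, ord_pred a.2), true)
                   + (z (a, false) + z ((ord_pred a.1, a.2), false)).
Proof.
rewrite /bd.
rewrite (eq_bigr (fun d => (fun x b => z (x, b) *
   ((a == gsrc (x, b) : bool) + (a == gtgt (x, b) : bool))) d.1 d.2)); last by case.
rewrite -(pair_bigA _ (fun x b => z (x, b) *
   ((a == gsrc (x, b) : bool) + (a == gtgt (x, b) : bool)))) /=.
under eq_bigr do rewrite big_bool /= !mulrDr.
rewrite !big_split /=; case: a => i j /=.
congr (_ + _ + (_ + _)).
- by rewrite (@sum_pick _ _ _ (i, j)) // => x; rewrite eq_sym.
- rewrite (@sum_pick _ _ _ (i, ord_pred j)) // => -[k l]; rewrite eq_sym /gtgt /=.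
  by rewrite !xpair_eqE /= (can2_eq (@ordSK N) (@ord_predK N)).
- by rewrite (@sum_pick _ _ _ (i, j)) // => x; rewrite eq_sym.
- rewrite (@sum_pick _ _ _ (ord_pred i, j)) // => -[k l]; rewrite eq_sym /gtgt /=.
  by rewrite !xpair_eqE /= (can2_eq (@ordSK N) (@ord_predK N)).
Qed.

Lemma grid_boundary_boundary (c : gpoint -> bool) a :
  bd gsrc gtgt (fun d => c (glft d) + c (grgt d)) a = 0.
Proof.
rewrite grid_bd /glft /grgt /=; case: a => i j /=.
by case: (c (i, j)); case: (c (ord_pred i, j)); case: (c (i, ord_pred j));
  case: (c (ord_pred i, ord_pred j)).
Qed.

Lemma val_ord_pred (i : 'I_N) : (0 < i)%N -> (ord_pred i).+1 = i :> nat.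
Proof.
move=> i0; have iN := ltn_ord i.
by rewrite /= (_ : (i + N).-1 = i.-1 + N)%N ?modnDr ?modn_small; lia.
Qed.

Lemma val_ord_pred0 (i : 'I_N) : i = 0%N :> nat -> (ord_pred i).+1 = N :> nat.
Proof.
by move=> i0; have iN := ltn_ord i; rewrite /= i0 add0n modn_small; lia.
Qed.

Lemma sum_le_pred (f : 'I_N -> bool) (i : 'I_N) : (0 < i)%N ->
  \sum_(k : 'I_N | (k <= i)%N) f k = f i + \sum_(k : 'I_N | (k <= ord_pred i)%N) f k.
Proof.
move=> i0; rewrite (bigD1 i) //=; congr (_ + _); apply: eq_bigl => k.
rewrite -val_eqE /=; have /= := val_ord_pred i0.
by move: ((i + N).-1 %% N)%N => p <-; rewrite -[RHS]ltnS [RHS]ltn_neqAle andbC.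
Qed.

Lemma sum_le0 (f : 'I_N -> bool) (i : 'I_N) : i = 0%N :> nat ->
  \sum_(k : 'I_N | (k <= i)%N) f k = f i.
Proof.
move=> i0; rewrite (big_pred1 i) // => k.
by rewrite /= -val_eqE /= i0 leqn0.
Qed.

(** The edges whose two cells do not lie on opposite sides of the wrap-around. *)
Definition ginner (d : gedge) : bool := if d.2 then (0 < d.1.1)%N else (0 < d.1.2)%N.

Definition off_border (a : gpoint) : bool :=
  [&& 0 < a.1, a.1.+1 < N, 0 < a.2 & a.2.+1 < N]%N.

(** The cell [(i, j)] gets the parity of the number of edges of [z] crossed on the
    way to it along its row. Across an edge in direction [true] this is immediate.
    Across the others, adding the boundary conditions at the vertices of one row
    of points makes the edges between consecutive vertices telescope. *)
Lemma grid_cycle_bounds (z : gedge -> bool) :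
  (forall d, z d -> off_border (gsrc d)) -> (forall a, bd gsrc gtgt z a = 0) ->
  exists c : gpoint -> bool, forall d, ginner d -> z d = c (glft d) + c (grgt d).
Proof.
move=> zi zc.
pose col j (i : 'I_N) := \sum_(k : 'I_N | (k <= i)%N) z ((k, j), true).
exists (fun x => col x.2 x.1) => -[[i j] []]; rewrite /ginner /glft /grgt /= => pos.
  rewrite /col [in X in _ + X]sum_le_pred //.
  by case: (z _); case: (\sum_(_ | _) _).
have vertex k : z ((k, ord_pred j), true) + z ((k, j), true)
    = z ((k, j), false) + z ((ord_pred k, j), false).
  have := zc (k, j); rewrite grid_bd /=.
  by case: (z (_, _, true)); case: (z (_, _, true)); case: (z (_, _, false)); case: (z (_, _, false)).
rewrite /col -big_split /=; under [RHS]eq_bigr do rewrite vertex.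
have [m] := ubnP i; elim: m => // m IH in i *; rewrite ltnS => im.
have [i0|i0] := posnP i.
  rewrite sum_le0 //; case E: (z (ord_pred i, j, false)); last by rewrite addr0.
  have := zi _ E; rewrite /off_border /gsrc => /and4P [_ /= + _ _].
  by have /= -> := val_ord_pred0 i0; rewrite ltnn.
rewrite sum_le_pred // -IH; first by case: (z _); case: (z _).
by have := val_ord_pred i0; lia.
Qed.

Theorem grid_minor_dual_ends (V : finType) (G : sgraph V) lab hat :
    is_minor G gsrc gtgt lab hat -> (forall a, lab a -> off_border a) ->
  exists phi psi : {set V} -> gpoint, dual_ends G phi psi.
Proof.
move=> mG labI; eexists; eexists.
apply: (minor_dual_ends (lft := glft) (rgt := grgt) (inner := ginner) mG).
- exact: grid_boundary_boundary.
- move=> [[i j] b] /orP [] /labI; rewrite /off_border /gsrc /gtgt /ginner /=;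
  by case: b => /and4P [].
- move=> z zl; apply: grid_cycle_bounds => d /zl /andP [h _]; exact: labI.
Qed.

Lemma joined_sym a b : joined gsrc gtgt a b = joined gsrc gtgt b a.
Proof. by apply: eq_existsb => d; rewrite orbC. Qed.

Lemma joined_row (i i' j : 'I_N) : i' = i.+1 :> nat -> joined gsrc gtgt (i, j) (i', j).
Proof.
move=> ii; apply/existsP; exists ((i, j), false); rewrite /gsrc /gtgt /= eqxx /=.
apply/orP; left; rewrite xpair_eqE eqxx andbT; apply/eqP/val_inj.
by rewrite /= modn_small -ii.
Qed.

Lemma joined_col (i j j' : 'I_N) : j' = j.+1 :> nat -> joined gsrc gtgt (i, j) (i, j').
Proof.
move=> jj; apply/existsP; exists ((i, j), true); rewrite /gsrc /gtgt /= eqxx /=.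
apply/orP; left; rewrite xpair_eqE eqxx /=; apply/eqP/val_inj.
by rewrite /= modn_small -jj.
Qed.

End Grid.

(** * From tubes to minors *)

Definition within_rel (T : finType) (g : rel T) (S : {set T}) : rel T :=
  fun a b => [&& a \in S, b \in S & g a b].

(** Follow the walk, restarting at every visit of [A] and stopping at the first
    visit of [B]. *)
Lemma crossing_path (T : finType) (g : rel T) (S A B : {set T}) a b :
    connect (within_rel g S) a b -> a \in A -> b \in B -> [disjoint A & B] ->
  exists a' q b', [/\ a' \in A, b' \in B, path g a' (rcons q b')
    & forall c, c \in q -> [/\ c \in S, c \notin A & c \notin B]].
Proof.
move=> /connectP [p] + -> aA + dAB; case: p => [_|c p] /=.
  by move=> aB; rewrite (disjointFr dAB aA) in aB.
move=> /andP [/and3P [_ cS gac] pS] bB.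
suff main : forall p c a q, a \in A -> c \in S -> path g a (rcons q c) ->
    (forall x, x \in q -> [/\ x \in S, x \notin A & x \notin B]) ->
    path (within_rel g S) c p -> last c p \in B ->
    exists a' q b', [/\ a' \in A, b' \in B, path g a' (rcons q b')
      & forall c, c \in q -> [/\ c \in S, c \notin A & c \notin B]].
  by apply: (main p c a [::]) => //=; rewrite gac.
clear c a p aA cS gac pS bB.
elim=> [|d p IH] c a q aA cS pac qS /=; first by exists a, q, c.
move=> /andP [/and3P [_ dS gcd] pd] lB.
have [cB|cB] := boolP (c \in B); first by exists a, q, c.
have [cA|cA] := boolP (c \in A).
  by apply: (IH d c [::]) => //=; rewrite gcd.
apply: (IH d a (rcons q c)) => //.
  by rewrite rcons_path pac last_rcons.
by move=> x; rewrite mem_rcons inE => /orP [/eqP->|/qS].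
Qed.

Section Tubes.
Variables (V : finType) (G : sgraph V) (T D : finType) (src tgt : D -> T).
Variables (box : V -> {set T}) (tube : {set V} -> {set T}) (v0 : V) (d0 : D).
Let g := joined src tgt.

Hypothesis box_connected : forall v a b, a \in box v -> b \in box v ->
  connect (within_rel g (box v)) a b.
Hypothesis box_inj : forall u v a, a \in box u -> a \in box v -> u = v.
Hypothesis tube_connected : forall e, e \in edges G -> exists x y a b,
  [/\ e = [set x; y]%SET, x != y, a \in box x, b \in box y
    & connect (within_rel g (tube e)) a b].
Hypothesis tube_box : forall e a u, e \in edges G -> a \in tube e -> a \in box u -> u \in e.
Hypothesis tube_tube : forall e f a, e \in edges G -> f \in edges G -> e != f ->
  a \in tube e -> a \in tube f -> exists u, a \in box u.

(** How one edge crosses from the box of one end to the box of the other: the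
    points strictly between the boxes are [middle], and [bridge] is the last step
    of the walk. The branch set of [near_end] will absorb [middle]. *)
Record link := Link {
  near_end : V; far_end : V; start : T; middle : seq T; finish : T; bridge : D }.

Definition link_spec (e : {set V}) (l : link) : Prop :=
  [/\ e = [set near_end l; far_end l]%SET, near_end l != far_end l,
      start l \in box (near_end l), finish l \in box (far_end l) &
   [/\ path g (start l) (middle l),
      forall c, c \in middle l -> c \in tube e /\ forall u, c \notin box u &
      let m := last (start l) (middle l) in
      ((src (bridge l) == m) && (tgt (bridge l) == finish l)) ||
      ((src (bridge l) == finish l) && (tgt (bridge l) == m))]].

Lemma links : exists l : {set V} -> link, forall e, e \in edges G -> link_spec e (l e).
Proof.
suff /boolp.choice [l hl] : forall e, exists l, e \in edges G -> link_spec e l by exists l.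
move=> e; have [eE|_] := boolP (e \in edges G); last first.
  by exists (Link v0 v0 (src d0) [::] (src d0) d0).
have [x [y [a [b [ee xy ax by_ conn]]]]] := tube_connected eE.
have dxy : [disjoint box x & box y].
  apply/pred0P => c /=; apply/negP=> /andP [cx cy].
  by rewrite (box_inj cx cy) eqxx in xy.
have [a' [q [b' [a'x b'y]]]] := crossing_path conn ax by_ dxy.
rewrite rcons_path => /andP [pq /existsP [d dE]] qS.
exists (Link x y a' q b' d) => _; split=> //=; split=> // c /qS [ct cx cy].
split=> // u; apply/negP=> cu; have := tube_box eE ct cu; rewrite ee !inE.
by case/orP=> /eqP uE; rewrite uE ?(negbTE cx) ?(negbTE cy) in cu.
Qed.

(** The branch set of [v] is its box together with the middle parts of the links
    whose near end is [v]; two middle parts are disjoint because tubes only meet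
    inside boxes. *)
Theorem minor_of_tubes : exists lab hat, is_minor G src tgt lab hat /\
  forall a, lab a -> (exists v, a \in box v) \/ (exists2 e, e \in edges G & a \in tube e).
Proof.
have [l hl] := links.
pose lab a := if [pick u | a \in box u] is Some u then Some u else
  if [pick e in edges G | a \in middle (l e)] is Some e then Some (near_end (l e)) else None.
have lab_box a u : a \in box u -> lab a = Some u.
  by move=> au; rewrite /lab; case: pickP => [v av|/(_ u)]; [rewrite (box_inj au av)|rewrite au].
have lab_mid a e : e \in edges G -> a \in middle (l e) -> lab a = Some (near_end (l e)).
  move=> eE am; have [_ _ _ _ [_ /(_ a am) [ate nbox] _]] := hl e eE.
  rewrite /lab; case: pickP => [v av|_]; first by have := nbox v; rewrite av.
  case: pickP => [f /andP [fE fm]|/(_ e)]; last by rewrite eE am.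
  have [_ _ _ _ [_ /(_ a fm) [atf _] _]] := hl f fE.
  have [-> //|ef] := eqVneq f e.
  by have [u] := tube_tube fE eE ef atf ate; rewrite (negbTE (nbox u)).
have labP a v : lab a = Some v ->
    a \in box v \/ exists e, [/\ e \in edges G, a \in middle (l e) & near_end (l e) = v].
  rewrite /lab; case: pickP => [u au [<-]|_]; first by left.
  by case: pickP => [e /andP [eE am] [<-]|//]; right; exists e.
have lab_last e : e \in edges G ->
    lab (last (start (l e)) (middle (l e))) = Some (near_end (l e)).
  move=> eE; have [_ _ sx _ _] := hl e eE.
  have := mem_last (start (l e)) (middle (l e)); rewrite inE.
  by case/orP=> [/eqP->|]; [exact: lab_box|exact: lab_mid].
exists lab, (fun e => bridge (l e)); split; last first.
  move=> a; case E: (lab a) => [v|//] _; case: (labP _ _ E) => [av|[e [eE am _]]].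
    by left; exists v.
  by right; exists e => //; have [_ _ _ _ [_ /(_ a am) [] ]] := hl e eE.
split=> [e eE|v].
  have [ee xy sx fy [_ _ /orP [] /andP [/eqP-> /eqP->]]] := hl e eE.
    by exists (near_end (l e)), (far_end (l e)); rewrite lab_last // (lab_box _ _ fy).
  exists (far_end (l e)), (near_end (l e)).
  by rewrite lab_last // (lab_box _ _ fy) eq_sym finset.setUC.
have blob_sym : connect_sym (blob_rel src tgt lab).
  apply: sym_connect_sym => a b; rewrite /blob_rel eq_sym; congr (_ && _).
  by apply: eq_existsb => d; rewrite orbC.
have to_box a : lab a = Some v -> exists2 c, c \in box v & connect (blob_rel src tgt lab) c a.
  move=> /labP [av|[e [eE am <-]]]; first by exists a.
  have [_ _ sx _ [pm _ _]] := hl e eE.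
  exists (start (l e)) => //; apply: (@path_connect _ _ _ (middle (l e))); last first.
    by rewrite inE am orbT.
  apply: (sub_in_path (P := [pred c | lab c == Some (near_end (l e))])) pm.
    by move=> c d /eqP lc /eqP ld gcd; rewrite /blob_rel lc ld eqxx.
  rewrite /= (lab_box _ _ sx) eqxx /=; apply/allP => c cm /=.
  by rewrite (lab_mid _ _ eE cm).
move=> a b /to_box [c cv ca] /to_box [d dv db].
rewrite blob_sym in ca; apply: connect_trans ca (connect_trans _ db).
apply: connect_sub (box_connected cv dv) => x y /and3P [xv yv gxy].
by apply: connect1; rewrite /blob_rel (lab_box _ _ xv) (lab_box _ _ yv) eqxx.
Qed.

End Tubes.

(** * Drawings at the scale of the grid *)

Section Discretization.
Variable R : realType.

(** Distance at most [r] in the maximum norm, whose balls are squares. *)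
Definition close_by (r : R) (p q : R * R) : bool :=
  (`|p.1 - q.1| <= r) && (`|p.2 - q.2| <= r).

Lemma close_byC r p q : close_by r p q = close_by r q p.
Proof. by rewrite /close_by distrC (distrC p.2). Qed.

Lemma close_by_trans r s q p t : close_by r p q -> close_by s q t -> close_by (r + s) p t.
Proof.
move=> /andP [h1 h2] /andP [h3 h4]; apply/andP; split.
  by rewrite (le_trans (ler_distD q.1 _ _)) ?lerD.
by rewrite (le_trans (ler_distD q.2 _ _)) ?lerD.
Qed.

Lemma close_byW r s p q : r <= s -> close_by r p q -> close_by s p q.
Proof. by move=> rs /andP [h1 h2]; rewrite /close_by !(le_trans _ rs). Qed.

Variable N : nat.

(** The grid has unit spacing; drawings are rescaled to it. *)
Definition gp (a : gpoint N) : R * R := (a.1%:R, a.2%:R).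

Let g := joined (@gsrc N) (@gtgt N).

Definition between (i k j : nat) : bool := (i <= k <= j)%N || (j <= k <= i)%N.

Lemma within_sym S : connect_sym (within_rel g S).
Proof.
apply: sym_connect_sym => a b; rewrite /within_rel andbCA; do 2 congr (_ && _).
exact: joined_sym.
Qed.

(** [f] enumerates a row or a column. *)
Lemma line_connect (f : 'I_N -> gpoint N) (S : {set gpoint N}) (i i' : 'I_N) :
  (forall k k' : 'I_N, k' = k.+1 :> nat -> g (f k) (f k')) ->
  (forall k : 'I_N, between i k i' -> f k \in S) ->
  connect (within_rel g S) (f i) (f i').
Proof.
move=> step; wlog ii : i i' / (i <= i')%N.
  move=> h hS; case: (leqP i i') => ii; first exact: h.
  rewrite within_sym; apply: h (ltnW ii) _ => k; rewrite /between orbC => kb.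
  exact: hS.
move=> hS; have [m] := ubnP (i' - i); elim: m => // m IH in i ii hS *; rewrite ltnS => im.
have [E|lt] := eqVneq i i'; first by rewrite E.
have {}lt : (i < i')%N by rewrite ltn_neqAle lt ii.
have i1 : (i.+1 < N)%N by exact: leq_ltn_trans (ltn_ord i').
apply: (@connect_trans _ _ (f (Ordinal i1))).
  apply: connect1; rewrite /within_rel !hS /between /=; last 2 first.
  - by rewrite ?leqnn ?leqnSn ?lt ?ii.
  - by rewrite leqnn ii.
  exact: step.
apply: IH => //=; last by lia.
move=> k kb; apply: hS; move: kb; rewrite /between /=; lia.
Qed.

Lemma between_close (i k j : nat) (x r : R) : between i k j ->
  `|i%:R - x| <= r -> `|j%:R - x| <= r -> `|k%:R - x| <= r.
Proof.
move=> b; rewrite !ler_norml => /andP [i1 i2] /andP [j1 j2].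
by case/orP: b => /andP []; rewrite -!(ler_nat R) => h1 h2; apply/andP; split; lra.
Qed.

(** The grid points in a square are connected: move along one coordinate, then
    along the other. *)
Lemma block_connect (S : {set gpoint N}) r p a b :
  close_by r (gp a) p -> close_by r (gp b) p ->
  (forall c, close_by r (gp c) p -> c \in S) -> connect (within_rel g S) a b.
Proof.
case: a b => [i j] [i' j'] /andP /= [i1 j1] /andP /= [i2 j2] hS.
apply: (@connect_trans _ _ (i, j')).
  apply: (@line_connect (fun k => (i, k))) => [k k'|k kb]; first exact: joined_col.
  apply: hS; rewrite /close_by /= i1 /=.
  exact: between_close kb j1 j2.
apply: (@line_connect (fun k => (k, j'))) => [k k'|k kb]; first exact: joined_row.
apply: hS; rewrite /close_by /= j2 andbT.
exact: between_close kb i1 i2.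
Qed.

Lemma round_coord (x : R) : 0 <= x -> x + 1 <= N%:R ->
  exists i : 'I_N, `|i%:R - x| <= 2^-1.
Proof.
move=> x0 xN; have y0 : 0 <= x + 2^-1 by rewrite addr_ge0 // invr_ge0.
have /andP [h1 h2] := truncn_itv y0.
have iN : (Num.truncn (x + 2^-1) < N)%N.
  by rewrite -(ltr_nat R); lra.
exists (Ordinal iN); rewrite /= ler_norml; move: h2; rewrite -(@natr1 R (Num.truncn _)) => h2.
by apply/andP; split; lra.
Qed.

(** The margin keeps all grid points within [r] of [p] off the border. *)
Definition inside (r : R) (p : R * R) : Prop :=
  [/\ r + 1 <= p.1, p.1 + r + 2 <= N%:R, r + 1 <= p.2 & p.2 + r + 2 <= N%:R].

Lemma round_point r p : 0 <= r -> inside r p -> exists a, close_by 2^-1 (gp a) p.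
Proof.
move=> r0 [h1 h2 h3 h4].
have [||i hi] := @round_coord p.1; [lra|lra|].
have [||j hj] := @round_coord p.2; [lra|lra|].
by exists (i, j); apply/andP.
Qed.

Lemma inside_off_border r p a : inside r p -> close_by r (gp a) p -> off_border a.
Proof.
move=> [h1 h2 h3 h4] /andP []; rewrite /off_border !ler_norml /=.
move=> /andP [a1 a2] /andP [a3 a4]; rewrite -!(ltr_nat R) -!natr1.
by apply/and4P; split; lra.
Qed.

Variables (V : finType) (G : sgraph V) (pt : V -> R * R) (gam : {set V} -> R -> R * R).
Variable rho : R.
Hypothesis rho1 : 1 <= rho.
Hypothesis pt_far : forall u v, close_by (2 * rho) (pt u) (pt v) -> u = v.
Hypothesis arc_far : forall e t u, e \in edges G -> t \in `[0, 1] ->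
  close_by (rho + 1) (gam e t) (pt u) -> u \in e.
(** Two arcs can be within [2] of each other only near a vertex; a grid point in
    two tubes then lies in a box. *)
Hypothesis arcs_far : forall e f s t, e \in edges G -> f \in edges G -> e != f ->
  s \in `[0, 1] -> t \in `[0, 1] -> close_by 2 (gam e s) (gam f t) ->
  exists u, close_by (rho - 1) (gam e s) (pt u).
Hypothesis arc_ends : forall e, e \in edges G -> exists x y,
  [/\ e = [set x; y]%SET, gam e 0 = pt x & gam e 1 = pt y].
Hypothesis arc_steps : forall e, e \in edges G -> exists2 M : nat, (0 < M)%N &
  forall j, (j < M)%N -> close_by 2^-1 (gam e (j%:R / M%:R)) (gam e (j.+1%:R / M%:R)).
Hypothesis pt_inside : forall v, inside rho (pt v).
Hypothesis arc_inside : forall e t, e \in edges G -> t \in `[0, 1] -> inside rho (gam e t).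

Definition box v : {set gpoint N} := [set a | close_by rho (gp a) (pt v)]%SET.
Definition tube e : {set gpoint N} :=
  [set a | `[< exists2 t, t \in `[0, 1] & close_by 1 (gp a) (gam e t) >]]%SET.

Lemma tubeP e a : reflect (exists2 t, t \in `[0, 1] & close_by 1 (gp a) (gam e t)) (a \in tube e).
Proof. by rewrite inE; exact: asboolP. Qed.

(** Round sample points of the arc to the grid. Consecutive samples are within
    1/2, so both roundings lie in the square of half-side 1 around the first
    sample, whose grid points all belong to the tube. *)
Lemma arc_connect e a b : e \in edges G ->
  close_by 2^-1 (gp a) (gam e 0) -> close_by 2^-1 (gp b) (gam e 1) ->
  connect (within_rel g (tube e)) a b.
Proof.
move=> eE a0 b1; have [M M0 step] := arc_steps eE.
have M0' : (0 : R) < M%:R by rewrite ltr0n.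
have tin j : (j <= M)%N -> (j%:R / M%:R : R) \in `[0, 1].
  by move=> jM; rewrite in_itv /= divr_ge0 //= ler_pdivrMr // mul1r ler_nat.
have half1 : (2^-1 : R) <= 1 by lra.
suff main j c : (j <= M)%N -> close_by 2^-1 (gp c) (gam e (j%:R / M%:R)) ->
    connect (within_rel g (tube e)) a c.
  by apply: (main M) => //; rewrite divff // gt_eqF.
elim: j c => [|j IH] c jM cj.
  apply: (@block_connect _ 1 (gam e 0)); [exact: close_byW a0| |].
    by move: cj; rewrite mul0r; exact: close_byW.
  by move=> d d1; apply/tubeP; exists 0; rewrite // in_itv /= lexx ler01.
have [c' c'j] := round_point (le_trans ler01 rho1) (arc_inside eE (tin j (ltnW jM))).
apply: (connect_trans (IH _ (ltnW jM) c'j)).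
apply: (@block_connect _ 1 (gam e (j%:R / M%:R))); first exact: close_byW c'j.
  apply: (@close_byW (2^-1 + 2^-1)); first lra.
  by apply: close_by_trans cj _; rewrite close_byC; exact: step.
by move=> d d1; apply/tubeP; exists (j%:R / M%:R) => //; apply: tin; exact: ltnW.
Qed.

Theorem coarse_drawing_minor (v0 : V) : (0 < N)%N -> exists lab hat,
  is_minor G (@gsrc N) (@gtgt N) lab hat /\ forall a, lab a -> off_border a.
Proof.
move=> N0; have i0 := Ordinal N0.
have [|||||lab [hat [mG labP]]] :=
  @minor_of_tubes V G _ _ (@gsrc N) (@gtgt N) box tube v0 ((i0, i0), false).
- move=> v a b; rewrite !inE => av bv; apply: block_connect av bv _ => c cv.
  by rewrite inE.
- move=> u v a; rewrite !inE => au av; apply: pt_far.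
  apply: (@close_byW (rho + rho)); first lra.
  by apply: close_by_trans av; rewrite close_byC.
- move=> e eE; have [x [y [ee ex ey]]] := arc_ends eE.
  have [a ha] := round_point (le_trans ler01 rho1) (pt_inside x).
  have [b hb] := round_point (le_trans ler01 rho1) (pt_inside y).
  have half : 2^-1 <= rho by apply: le_trans rho1; lra.
  exists x, y, a, b; split; rewrite ?inE ?(close_byW half) //.
    by move: (card_edge eE); rewrite ee cards2; case: eqP.
  by apply: arc_connect; rewrite ?ex ?ey.
- move=> e a u eE /tubeP [t t01 at1]; rewrite inE => au.
  apply: (arc_far eE t01); rewrite addrC; apply: close_by_trans au.
  by rewrite close_byC.
- move=> e f a eE fE ef /tubeP [s s01 as1] /tubeP [t t01 at1].
  have [|u hu] := arcs_far eE fE ef s01 t01.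
    apply: (@close_byW (1 + 1)); first lra.
    by apply: close_by_trans at1; rewrite close_byC.
  exists u; rewrite inE; apply: (@close_byW (1 + (rho - 1))); first lra.
  exact: close_by_trans as1 hu.
exists lab, hat; split=> // a /labP [[v]|[e eE /tubeP [t t01 at1]]].
  by rewrite inE; exact: inside_off_border.
by apply: (inside_off_border (arc_inside eE t01)); exact: close_byW at1.
Qed.

End Discretization.

(** * Compactness of arcs *)

Section UnitInterval.
Variable R : realType.

Lemma near0P (P : R -> Prop) :
  (\forall e \near (0 : R)^'+%classic, P e) <->
  exists2 d : R, 0 < d & forall e : R, 0 < e < d -> P e.
Proof.
split=> [[d /= d0 h]|[d d0 h]].
  exists d => // e /andP [e0 ed]; apply: h => //=.
  by rewrite sub0r normrN gtr0_norm.
exists d => // e; rewrite /ball_ /= sub0r normrN => + e0.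
by rewrite gtr0_norm // => ed; apply: h; rewrite e0.
Qed.

(** Compactness of the unit interval, in the form: a property of a small parameter
    and a point that holds locally holds uniformly. *)
Lemma unit_cover (P : R -> R -> Prop) :
  (forall t : R, t \in `[0, 1] -> exists2 d : R, 0 < d &
     forall e u : R, 0 < e < d -> u \in `[0, 1] -> `|t - u| < d -> P e u) ->
  (\forall e \near (0 : R)^'+%classic, forall t : R, t \in `[0, 1] -> P e t).
Proof.
move=> h.
have /compact_near_coveringP cov := @segment_compact R 0 1.
suff loc : forall t : R, `[0, 1]%classic t ->
    (\forall u \near (t : R) & e \near (0 : R)^'+%classic, u \in `[0, 1] -> P e u).
  have filt : Filter (0 : R)^'+%classic by exact: filter_filter.
  have /near0P [d d0 hd] := cov R _ (fun e u => u \in `[0, 1] -> P e u) filt loc.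
  by apply/near0P; exists d => // e ed t t01; exact: (hd e ed t t01).
move=> t t01; have [d d0 hd] := h t t01.
exists ((ball t d), [set e | 0 < e < d])%classic => /=.
  split; first exact: nbhsx_ballx.
  by apply/near0P; exists d.
by move=> [u e] /= [ud ed] u01; exact: hd.
Qed.

Lemma square_cover (P : R -> R -> R -> Prop) :
  (forall s t : R, s \in `[0, 1] -> t \in `[0, 1] -> exists2 d : R, 0 < d &
     forall e s' t' : R, 0 < e < d -> s' \in `[0, 1] -> t' \in `[0, 1] ->
       `|s - s'| < d -> `|t - t'| < d -> P e s' t') ->
  (\forall e \near (0 : R)^'+%classic, forall s t : R, s \in `[0, 1] -> t \in `[0, 1] -> P e s t).
Proof.
move=> h.
suff loc s : s \in `[0, 1] -> exists2 d : R, 0 < d & forall e u : R, 0 < e < d ->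
    u \in `[0, 1] -> `|s - u| < d -> forall t : R, t \in `[0, 1] -> P e u t.
  have /near0P [d d0 hd] := unit_cover loc.
  by apply/near0P; exists d => // e ed s t s01; exact: hd.
move=> s01.
(* Cover in [t] first: the small parameter also bounds the distance to [s], so
   that one value of it serves for all [t]. *)
have /near0P [d d0 hd] : (\forall e \near (0 : R)^'+%classic, forall t : R, t \in `[0, 1] ->
    forall e' s' : R, 0 < e' < e -> s' \in `[0, 1] -> `|s - s'| < e -> P e' s' t).
  apply: unit_cover => t t01; have [d d0 hd] := h s t s01 t01.
  exists d => // e u /andP [e0 ed] u01 tu e' s' /andP [e'0 e'e] s'01 ss'.
  by apply: hd => //; [rewrite e'0 (lt_trans e'e)|exact: lt_trans ed].
exists (d / 2); first by lra.
move=> e u ed u01 su t t01; apply: (hd (d / 2)) => //; lra.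
Qed.

Definition path_cont (f : R -> R * R) : Prop :=
  forall t e : R, t \in `[0, 1] -> 0 < e -> exists2 d : R, 0 < d &
    forall u : R, u \in `[0, 1] -> `|t - u| < d -> close_by e (f t) (f u).

Lemma within_path_cont (f : R -> R * R) :
  {within `[0, 1]%classic, continuous f}%classic -> path_cont f.
Proof.
move=> /subspace_continuousP cf t e t01 e0.
have := cf t t01 _ (nbhsx_ballx (f t) e e0).
rewrite nbhs_simpl /= /within /= => /nbhs_ballP [d /= d0 hd].
exists d => // u u01 tu; have [h1 h2] := hd u tu u01.
by rewrite /close_by !ltW.
Qed.

Lemma cst_path_cont p : path_cont (fun=> p).
Proof.
by move=> t e _ e0; exists 1 => // u _ _; rewrite /close_by !subrr normr0 ltW.
Qed.

Lemma not_close (p q : R * R) : p <> q -> exists2 d : R, 0 < d & ~~ close_by d p q.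
Proof.
move=> pq; have [E1|N1] := eqVneq p.1 q.1.
  have N2 : p.2 != q.2.
    by apply/eqP=> E2; apply: pq; case: p q E1 E2 => a b [c d] /= -> ->.
  exists (`|p.2 - q.2| / 2); first by rewrite divr_gt0 ?normr_gt0 ?subr_eq0.
  rewrite negb_and -!ltNge; apply/orP; right.
  by rewrite ltr_pdivrMr // ltr_pMr ?ltr1n // normr_gt0 subr_eq0.
exists (`|p.1 - q.1| / 2); first by rewrite divr_gt0 ?normr_gt0 ?subr_eq0.
rewrite negb_and -!ltNge; apply/orP; left.
by rewrite ltr_pdivrMr // ltr_pMr ?ltr1n // normr_gt0 subr_eq0.
Qed.

(** If the values of [f] that are also values of [g] lie in the interior of [Q],
    then so do the values of [f] that are sufficiently close to values of [g]. *)
Lemma separation (f g : R -> R * R) (Q : R * R -> Prop) :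
  path_cont f -> path_cont g ->
  (forall s t : R, s \in `[0, 1] -> t \in `[0, 1] -> f s = g t ->
    exists2 d : R, 0 < d & forall p, close_by d (f s) p -> Q p) ->
  (\forall e \near (0 : R)^'+%classic, forall s t : R, s \in `[0, 1] -> t \in `[0, 1] ->
    close_by e (f s) (g t) -> Q (f s)).
Proof.
move=> cf cg h; apply: square_cover => s t s01 t01.
have [E|/not_close [d d0 dfg]] := pselect (f s = g t).
  have [r r0 hr] := h s t s01 t01 E.
  have [d d0 hd] := cf s r s01 r0.
  by exists d => // e s' t' _ s'01 _ ss' _ _; apply: hr; exact: hd.
have d3 : 0 < d / 3 by lra.
have [d1 d10 h1] := cf s _ s01 d3; have [d2 d20 h2] := cg t _ t01 d3.
exists (Num.min (d / 3) (Num.min d1 d2)); first by rewrite !lt_min d3 d10 d20.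
move=> e s' t' /andP [e0]; rewrite !lt_min => /and3P [ed _ _] s'01 t'01.
move=> /and3P [_ ss' _] /and3P [_ _ tt'] cl; case/negP: dfg.
apply: (@close_byW _ (d / 3 + (d / 3 + d / 3))); first lra.
apply: (close_by_trans (h1 _ s'01 ss')); apply: (@close_by_trans _ _ _ (g t')).
  by apply: close_byW cl; exact: ltW.
by rewrite close_byC; exact: h2.
Qed.

Lemma unif_steps f r : path_cont f -> 0 < r -> exists2 M : nat, (0 < M)%N &
  forall j, (j < M)%N -> close_by r (f (j%:R / M%:R)) (f (j.+1%:R / M%:R)).
Proof.
move=> cf r0.
have /near0P [d d0 hd] : (\forall e \near (0 : R)^'+%classic, forall t : R, t \in `[0, 1] ->
    forall u : R, u \in `[0, 1] -> `|t - u| < e -> close_by r (f t) (f u)).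
  apply: unit_cover => t t01; have r2 : 0 < r / 2 by lra.
  have [d d0 hd] := cf t _ t01 r2; exists (d / 2); first lra.
  move=> e u /andP [e0 ed] u01 tu v v01 uv.
  apply: (@close_byW _ (r / 2 + r / 2)); first lra.
  apply: (@close_by_trans _ _ _ (f t)); first by rewrite close_byC; apply: hd => //; lra.
  apply: hd => //; apply: le_lt_trans (ler_distD u _ _) _; lra.
have [M hM] : exists M : nat, 2 / d < M%:R.
  by exists (Num.truncn (2 / d)).+1; apply: truncnS_gt.
have M0 : (0 : R) < M%:R by apply: lt_trans hM; rewrite divr_gt0.
exists M; first by rewrite -(ltr0n R).
have tin j : (j <= M)%N -> (j%:R / M%:R : R) \in `[0, 1].
  by move=> jM; rewrite in_itv /= divr_ge0 //= ler_pdivrMr // mul1r ler_nat.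
move=> j jM; apply: (hd (d / 2)); [lra|exact/tin/ltnW|exact: tin|].
rewrite -mulrBl -natr1 opprD addNKr mulNr normrN mul1r gtr0_norm ?invr_gt0 //.
by rewrite invf_plt ?posrE ?divr_gt0 // invf_div.
Qed.

(** The bound is the inverse of the small parameter, so that it can be chosen
    together with the other constants. *)
Lemma path_bounded f : path_cont f ->
  (\forall e \near (0 : R)^'+%classic, forall t : R, t \in `[0, 1] -> close_by e^-1 (f t) (0, 0)).
Proof.
move=> cf; apply: unit_cover => t t01; have [d d0 hd] := cf t 1 t01 ltr01.
set B := `|(f t).1| + `|(f t).2|.
have B0 : 0 <= B by rewrite addr_ge0.
have B1 : 0 < 1 + B by lra.
exists (Num.min d (1 + B)^-1); first by rewrite lt_min d0 invr_gt0.
move=> e u /andP [e0]; rewrite !lt_min => /andP [_ eB] u01 /andP [tu _].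
apply: (@close_byW _ (1 + B)).
  by rewrite -[1 + B]invrK lef_pV2 ?posrE ?invr_gt0 // ltW.
apply: (@close_by_trans _ _ _ (f t)); first by rewrite close_byC; exact: hd.
by rewrite /close_by /= !subr0 /B lerDl lerDr !normr_ge0.
Qed.

End UnitInterval.

(** * Planar graphs have algebraic duals *)

Section Planar.
Variable R : realType.

Lemma near0_imp (b : bool) (P : R -> Prop) :
  (b -> \forall e \near (0 : R)^'+%classic, P e) ->
  \forall e \near (0 : R)^'+%classic, b -> P e.
Proof.
case: b => [/(_ isT) /near0P [d d0 h]|_]; apply/near0P; last by exists 1.
by exists d => // e ed _; exact: h.
Qed.

Lemma near0_forall (I : finType) (P : I -> R -> Prop) :
  (forall i, \forall e \near (0 : R)^'+%classic, P i e) ->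
  \forall e \near (0 : R)^'+%classic, forall i, P i e.
Proof. by move=> h; apply: filter_forall. Qed.

Lemma near0_ex2 (P Q : R -> Prop) :
  (\forall e \near (0 : R)^'+%classic, P e) ->
  (\forall e \near (0 : R)^'+%classic, Q e) ->
  exists2 e : R, 0 < e & P e /\ Q e.
Proof.
move=> /near0P [d d0 hd] /near0P [d' d'0 hd'].
have m0 : 0 < Num.min d d' by rewrite lt_min d0.
have md : Num.min d d' / 2 < Num.min d d' by lra.
exists (Num.min d d' / 2); first lra.
move: md; rewrite lt_min => /andP [h1 h2].
by split; [apply: hd|apply: hd']; rewrite divr_gt0.
Qed.

Definition rescale (A d : R) (p : R * R) : R * R := ((p.1 + A) / d, (p.2 + A) / d).

Lemma close_by_rescale A d r p q : 0 < d ->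
  close_by r (rescale A d p) (rescale A d q) = close_by (r * d) p q.
Proof.
move=> d0; rewrite /close_by /rescale /= -!mulrBl !normrM.
rewrite (gtr0_norm (x := d^-1)) ?invr_gt0 // !ler_pdivrMr //.
have sub x y : x + A - (y + A) = x - y by ring.
by rewrite !sub.
Qed.

Variables (V : finType) (G : sgraph V).

(** All constants come from compactness, in this order: [r] separates each vertex
    from the other vertices and from the arcs not ending there, the squares around
    the vertices get half-side [rho0], then [eps] bounds the drawing by its
    inverse and separates distinct arcs outside the squares of half-side
    [rho0 / 2], and [d] is the grid spacing. *)
Theorem planar_dual_ends (v0 : V) : planar R G ->
  exists N, exists phi psi : {set V} -> gpoint N, dual_ends G phi psi.
Proof.
case=> pos [arc [pinj ends novert disj]].
have cont e : e \in edges G -> path_cont (arc e).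
  by move=> /ends [x [y [_ [c _ _ _]]]]; exact: within_path_cont.
have i01 : (0 : R) \in `[0, 1] by rewrite in_itv /= lexx ler01.
have endpt e (t : R) : e \in edges G -> t \in `[0, 1] -> t \notin `]0, 1[ ->
    exists2 u, u \in e & arc e t = pos u.
  move=> /ends [x [y [-> [_ _ a0 a1]]]]; rewrite !in_itv /= => /andP [t0 t1].
  rewrite negb_and -!leNgt => /orP [t00|t11].
    by exists x; [rewrite !inE eqxx|rewrite -a0; congr (arc _ _); apply/le_anti/andP].
  by exists y; [rewrite !inE eqxx orbT|rewrite -a1; congr (arc _ _); apply/le_anti/andP].
have avoid e (t : R) u : e \in edges G -> t \in `[0, 1] -> arc e t = pos u -> u \in e.
  move=> eE t01 atu; have [ti|tn] := boolP (t \in `]0, 1[).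
    by case: (novert e t u eE ti).
  by have [w we] := endpt e t eE t01 tn; rewrite atu => /pinj ->.
have cross e f (s t : R) : e \in edges G -> f \in edges G -> e != f ->
    s \in `[0, 1] -> t \in `[0, 1] -> arc e s = arc f t -> exists u, arc e s = pos u.
  move=> eE fE ef s01 t01 est; have [si|sn] := boolP (s \in `]0, 1[).
    by case: (disj e f s t eE fE ef si t01).
  by have [w _ sw] := endpt e s eE s01 sn; exists w.
have [r r0 [far_pos far_arc]] : exists2 r : R, 0 < r &
    (forall u v, u != v -> ~~ close_by r (pos u) (pos v)) /\
    (forall e u, e \in edges G -> u \notin e ->
       forall t : R, t \in `[0, 1] -> ~~ close_by r (arc e t) (pos u)).
  apply: near0_ex2.
    apply: near0_forall => u; apply: near0_forall => v; apply: near0_imp => uv.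
    have /near0P [d d0 hd] : \forall e \near (0 : R)^'+%classic, forall s t : R,
        s \in `[0, 1] -> t \in `[0, 1] -> close_by e (pos u) (pos v) -> False.
      apply: (@separation R (fun=> pos u) (fun=> pos v) (fun=> False));
        [exact: cst_path_cont..|move=> s t _ _ /pinj E].
      by rewrite E eqxx in uv.
    by apply/near0P; exists d => // e ed; apply/negP => /(hd e ed 0 0 i01 i01).
  apply: near0_forall => e; apply: near0_forall => u; apply: near0_imp => eE.
  apply: near0_imp => ue.
  have /near0P [d d0 hd] : \forall x \near (0 : R)^'+%classic, forall s t : R,
      s \in `[0, 1] -> t \in `[0, 1] -> close_by x (arc e s) (pos u) -> False.
    apply: (@separation R (arc e) (fun=> pos u) (fun=> False));
      [exact: cont|exact: cst_path_cont|move=> s t s01 _ E].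
    by have := avoid e s u eE s01 E; rewrite (negbTE ue).
  apply/near0P; exists d => // x xd t t01; apply/negP => h.
  exact: (hd x xd t 0 t01 i01 h).
pose rho0 := r / 2.
have rho00 : 0 < rho0 by rewrite divr_gt0.
have [eps eps0 [[bpos barc] sep]] : exists2 eps : R, 0 < eps &
    ((forall u, close_by eps^-1 (pos u) (0, 0)) /\
     (forall e, e \in edges G -> forall t : R, t \in `[0, 1] -> close_by eps^-1 (arc e t) (0, 0))) /\
    (forall e f, e \in edges G -> f \in edges G -> e != f ->
       forall s t : R, s \in `[0, 1] -> t \in `[0, 1] -> close_by eps (arc e s) (arc f t) ->
       exists u, close_by (rho0 / 2) (arc e s) (pos u)).
  apply: near0_ex2.
    apply: filterI.
      apply: near0_forall => u.
      have /near0P [d d0 hd] := path_bounded (@cst_path_cont R (pos u)).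
      by apply/near0P; exists d => // e ed; exact: (hd e ed 0).
    by apply: near0_forall => e; apply: near0_imp => eE; apply: path_bounded; exact: cont.
  apply: near0_forall => e; apply: near0_forall => f.
  apply: near0_imp => eE; apply: near0_imp => fE; apply: near0_imp => ef.
  apply: (@separation R (arc e) (arc f) (fun p => exists u, close_by (rho0 / 2) p (pos u))
     (cont e eE) (cont f fE)) => s t s01 t01 E.
  have [u su] := cross e f s t eE fE ef s01 t01 E.
  by exists (rho0 / 2); [rewrite divr_gt0|move=> p; rewrite su close_byC => h; exists u].
pose d := Num.min (eps / 2) (rho0 / 2).
have d0 : 0 < d by rewrite lt_min !divr_gt0.
have deps : d <= eps / 2 by rewrite ge_min lexx.
have drho : d <= rho0 / 2 by rewrite ge_min lexx orbT.
pose B := eps^-1; have B0 : 0 < B by rewrite invr_gt0.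
(* Translating by [A] makes all coordinates positive with room to spare. *)
pose A := B + rho0 + 3 * d.
pose X := (B + A + rho0) / d.
pose N := (Num.truncn X).+4.
have X0 : 0 <= X by rewrite divr_ge0 // ?ltW // /A; lra.
have NX : X + 3 <= N%:R.
  have /andP [_] := truncn_itv X0; rewrite /N -(addn3 (Num.truncn X).+1) natrD; lra.
pose rho := rho0 / d.
have rhod : rho * d = rho0 by rewrite /rho divfK // gt_eqF.
have rho2 : 2 <= rho by rewrite /rho ler_pdivlMr //; lra.
have inside_rescale p : close_by B p (0, 0) -> inside N rho (rescale A d p).
  rewrite /close_by /= !subr0 !ler_norml => /andP [/andP [p1 p2] /andP [p3 p4]].
  have low x : - B <= x -> rho + 1 <= (x + A) / d.
    by move=> xB; rewrite ler_pdivlMr // mulrDl rhod mul1r /A; lra.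
  have up x : x <= B -> (x + A) / d + rho + 2 <= N%:R.
    move=> xB; apply: le_trans NX; rewrite /X /rho.
    have : (x + A) / d + rho0 / d <= (B + A + rho0) / d.
      by rewrite -mulrDl ler_pM2r ?invr_gt0 //; lra.
    lra.
  by split; rewrite /rescale /=; [exact: low|exact: up|exact: low|exact: up].
have scE r' p q : close_by r' (rescale A d p) (rescale A d q) = close_by (r' * d) p q.
  exact: close_by_rescale.
have [|||||||||lab [hat [mG labI]]] := @coarse_drawing_minor R N V G (rescale A d \o pos)
  (fun e t => rescale A d (arc e t)) rho _ _ _ _ _ _ _ _ v0.
- lra.
- move=> u v; rewrite /= scE -mulrA rhod => h; apply/eqP; apply: contraTT h => uv.
  apply: contra (far_pos u v uv); apply: close_byW; rewrite /rho0; lra.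
- move=> e t u eE t01; rewrite /= scE mulrDl rhod mul1r; apply: contraTT => ue.
  by apply: contra (far_arc e u eE ue t t01); apply: close_byW; rewrite /rho0 in drho *; lra.
- move=> e f s t eE fE ef s01 t01; rewrite scE => cl.
  have [|u hu] := sep e f eE fE ef s t s01 t01; first by apply: close_byW cl; lra.
  by exists u; rewrite /= scE; apply: close_byW hu; rewrite mulrBl rhod mul1r; lra.
- move=> e /ends [x [y [-> [_ _ a0 a1]]]]; exists x, y; split=> //=; by rewrite ?a0 ?a1.
- move=> e eE; have d2 : 0 < 2^-1 * d by rewrite mulr_gt0 // invr_gt0.
  have [M M0 step] := unif_steps (cont e eE) d2.
  by exists M => // j jM; rewrite scE; exact: step.
- by move=> v; apply: inside_rescale; exact: bpos.
- by move=> e t eE t01; apply: inside_rescale; exact: barc.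
- by [].
have [phi [psi dual]] := grid_minor_dual_ends mG labI.
by exists N, phi, psi.
Qed.

End Planar.

(** * The bound *)

Theorem theorem2 (R : realType) (n : nat) (hn : (4 <= n)%N) :
  (exP R n (cycle_graph 4))%:R <= 15 / 7 * (n%:R - 2) :> R.
Proof.
have bound : (7 * exP R n (cycle_graph 4) <= 15 * (n - 2))%N.
  rewrite mulnC -leq_divRL //; apply/bigmax_leqP => E /asboolP [G [<- pG fG]].
  rewrite leq_divRL // mulnC.
  have v0 : 'I_n by apply: (@Ordinal _ 0); apply: leq_trans hn.
  have [N [phi [psi dual]]] := planar_dual_ends v0 pG.
  rewrite -[n in (_ <= 15 * (n - 2))%N]card_ord; apply: (edge_bound fG dual).
    by rewrite card_ord.
  by apply/card_gt0P; exists (phi finset.set0).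
have n2 : (n - 2)%:R = n%:R - 2 :> R by rewrite natrB //; apply: leq_trans hn.
move: bound; rewrite -(ler_nat R) !natrM n2.
rewrite mulrAC ler_pdivlMr // mulrC; exact.
Qed.
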